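(* Let $n\geq 2$ be an integer, let $\Delta_n:=\{(i,j)\in\mathbb{Z}\times\mathbb{Z}\mid 0\leq i,\ 0\leq j,\ i+j\leq n\}$, and let $\Gamma\colon\Delta_n\to\mathbb{R}$ be a symmetric function such that $\Gamma(i,j)=1$ whenever $i\cdot j=0$, and $$\Gamma(i+j,k)\,\Gamma(i,j)=\Gamma(i,j+k)\,\Gamma(j,k)\qquad\text{for all integers } i,j,k\geq 0 \text{ with } i+j+k\leq n.$$ Let $d_0=\mathrm{id}\colon\mathbb{R}\to\mathbb{R}$ and let $d_1,\dots,d_{n-1}\colon\mathbb{R}\to\mathbb{R}$ be additive functions such that $$d_k(xy)=\sum_{i=0}^{k}\Gamma(i,k-i)\,d_i(x)\,d_{k-i}(y)\qquad(x,y\in\mathbb{R})$$ holds for every $k\in\{1,\dots,n-1\}$. Then there exists an additive function $d_n\colon\mathbb{R}\to\mathbb{R}$ such that the displayed functional equation is also valid for $k=n$.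
   Context: A function $a\colon\mathbb{R}\to\mathbb{R}$ is additive if $a(x+y)=a(x)+a(y)$ for all $x,y\in\mathbb{R}$ (no continuity or $\mathbb{R}$-linearity is assumed). Symmetric means $\Gamma(i,j)=\Gamma(j,i)$ for all $(i,j)\in\Delta_n$. The map $\mathrm{id}$ is the identity $x\mapsto x$. *)

(* Defs.v *)
From mathcomp Require Import all_boot all_order all_algebra.
From mathcomp Require Import reals.
Set Implicit Arguments.
Unset Strict Implicit.
Unset Printing Implicit Defensive.
Import Order.TTheory GRing.Theory Num.Theory.
Local Open Scope ring_scope.

(* The triangular index set; nonnegativity of the two integer coordinates is
   carried by the type nat. A function on Delta n is represented by a total
   function on nat * nat, whose values outside Delta n are never used. *)
Definition Delta (n : nat) : pred (nat * nat) :=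
  [pred ij | (ij.1 + ij.2 <= n)%N].

(* Only the values of d at indices <= k occur; k - i is truncated subtraction,
   which is harmless since i <= k. *)
Definition product_rule (R : realType) (Gamma : nat -> nat -> R)
    (d : nat -> R -> R) (k : nat) : Prop :=
  forall x y : R,
    d k (x * y) = \sum_(i < k.+1) Gamma i (k - i)%N * d i x * d (k - i)%N y.

(* Main.v *)
Require Import Defs.
From HB Require Import structures.
From mathcomp Require Import all_boot all_order all_algebra.
From mathcomp Require Import reals.
From mathcomp Require Import boolp classical_sets.
From mathcomp Require Import zify ring.
Set Implicit Arguments.
Unset Strict Implicit.
Unset Printing Implicit Defensive.
Import Order.TTheory GRing.Theory Num.Theory.
Local Open Scope ring_scope.

(** The desired equation reads [d_n (x y) = x d_n y + y d_n x + B x y], where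
    [B] is the sum of the terms with both indices positive, built from [d_1], ..., [d_(n-1)] only.  So the claim is
    that the symmetric biadditive map [B] is a coboundary.

    The product rules below [n] and the cocycle equation of [Gamma] make [B] a
    2-cocycle: [x B(y,z) + B(x, y z)] and [B(x y, z) + B(x,y) z] are the two
    ways of expanding the triple sum over [i + j + k = n]
    ([leibniz_sumA], [leibniz_cocycle]).

    A symmetric biadditive 2-cocycle on a field [K] is the same as a commutative
    ring structure on [K * K] which extends [K] by an ideal of square zero, with
    product [(x,a)(y,b) = (x y, x b + a y + B x y)].  A ring section
    [x |-> (x, f x)] of the first projection is exactly an additive [f] with
    [f (x y) = x f y + f x y + B x y], so it remains to find a section.

    In characteristic zero, every surjection [E -> K] onto a field whose kernel
    has square zero has a ring section ([ring_section_sq0]).  By Zorn's lemma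
    there is a maximal subring [S] of [E] that meets the kernel trivially.  If
    [t] in [K] is transcendental over the image of [S], any lift [u] of [t] can
    be adjoined to [S].  If [t] is algebraic, take a polynomial [p] of least
    degree over [S] whose image kills [t].  By minimality and characteristic
    zero, [p'] does not kill [t], so one Newton step turns any lift of [t] into
    an exact root [u] of [p], and [S[u]] still meets the kernel trivially
    ([ps_extend]).  Hence [S] maps onto [K], and the inverse of this bijection
    is the section. *)

(** * Ring sections of square-zero extensions *)

Section Lifting.
Variables (E : comNzRingType) (K : fieldType) (pi : {rmorphism E -> K}).

(** A subring on which [pi] is injective, seen as a section of [pi] over its
    image.  Membership of [1] is conditional so that the empty set qualifies:
    it is the union of the empty chain in Zorn's lemma. *)
Record partial_section (S : set E) : Prop := PartialSection {
  ps_1 : forall x, S x -> S 1;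
  ps_B : forall x y, S x -> S y -> S (x - y);
  ps_M : forall x y, S x -> S y -> S (x * y);
  ps_inj : forall x, S x -> pi x = 0 -> x = 0 }.

Lemma partial_section_bigcup (F : set (set E)) :
  (F `<=` partial_section)%classic -> total_on F subset ->
  partial_section (\bigcup_(X in F) X)%classic.
Proof.
move=> FP Ftot.
have joint x y : (\bigcup_(X in F) X)%classic x ->
    (\bigcup_(X in F) X)%classic y -> exists X, [/\ F X, X x & X y].
  move=> [X FX Xx] [Y FY Yy]; have [XY|YX] := Ftot _ _ FX FY.
    by exists Y; split=> //; apply: XY.
  by exists X; split=> //; apply: YX.
split.
- by move=> x [X FX Xx]; exists X => //; exact: (ps_1 (FP _ FX) Xx).
- move=> x y Ux Uy; have [X [FX Xx Xy]] := joint x y Ux Uy.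
  by exists X => //; exact: (ps_B (FP _ FX)).
- move=> x y Ux Uy; have [X [FX Xx Xy]] := joint x y Ux Uy.
  by exists X => //; exact: (ps_M (FP _ FX)).
- by move=> x [X FX Xx]; exact: (ps_inj (FP _ FX)).
Qed.

Section Adjunction.
Variables (S : set E) (Sps : partial_section S) (S1 : S 1).

Lemma ps_0 : S 0.
Proof. by rewrite -(subrr 1); apply: (ps_B Sps). Qed.

Lemma ps_N x : S x -> S (- x).
Proof. by move=> Sx; rewrite -sub0r; apply: (ps_B Sps) => //; exact: ps_0. Qed.

Lemma ps_D x y : S x -> S y -> S (x + y).
Proof.
by move=> Sx Sy; rewrite -[y]opprK; apply: (ps_B Sps) => //; exact: ps_N.
Qed.

Lemma ps_sum (I : Type) (r : seq I) (P : pred I) (F : I -> E) :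
  (forall i, P i -> S (F i)) -> S (\sum_(i <- r | P i) F i).
Proof. by move=> SF; apply: big_ind => //; [exact: ps_0 | exact: ps_D]. Qed.

Lemma ps_Mn x k : S x -> S (x *+ k).
Proof.
move=> Sx; elim: k => [|k IH]; first exact: ps_0.
by rewrite mulrS; apply: ps_D.
Qed.

Definition coefs_in (p : {poly E}) : Prop := forall i, S p`_i.

Lemma coefs_in_C c : S c -> coefs_in c%:P.
Proof. by move=> Sc i; rewrite coefC; case: eqP => // _; exact: ps_0. Qed.

Lemma coefs_in_X : coefs_in 'X.
Proof. by move=> i; rewrite coefX; case: eqP => // _; exact: ps_0. Qed.

Lemma coefs_in_B p q : coefs_in p -> coefs_in q -> coefs_in (p - q).
Proof. by move=> Sp Sq i; rewrite coefB; apply: (ps_B Sps). Qed.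

Lemma coefs_in_M p q : coefs_in p -> coefs_in q -> coefs_in (p * q).
Proof.
by move=> Sp Sq i; rewrite coefM; apply: ps_sum => j _; apply: (ps_M Sps).
Qed.

Lemma coefs_in_Xn k : coefs_in 'X^k.
Proof. by move=> i; rewrite coefXn; case: eqP => // _; exact: ps_0. Qed.

Lemma coefs_in_deriv p : coefs_in p -> coefs_in p^`().
Proof. by move=> Sp i; rewrite coef_deriv; apply: ps_Mn. Qed.

Definition adjoin (u : E) : set E := fun x => exists2 q, coefs_in q & x = q.[u].

Lemma adjoin_sub u : (S `<=` adjoin u)%classic.
Proof. by move=> c Sc; exists c%:P; [exact: coefs_in_C | rewrite hornerC]. Qed.

Lemma adjoin_gen u : adjoin u u.
Proof. by exists 'X; [exact: coefs_in_X | rewrite hornerX]. Qed.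

Lemma adjoin_partial_section u :
  (forall q, coefs_in q -> pi q.[u] = 0 -> q.[u] = 0) ->
  partial_section (adjoin u).
Proof.
move=> inj; split.
- by move=> _ _; apply: adjoin_sub.
- move=> _ _ [p Sp ->] [q Sq ->]; exists (p - q); first exact: coefs_in_B.
  by rewrite hornerD hornerN.
- move=> _ _ [p Sp ->] [q Sq ->]; exists (p * q); first exact: coefs_in_M.
  by rewrite hornerM.
- by move=> _ [q Sq ->]; exact: inj.
Qed.

End Adjunction.

Hypothesis pi_surj : forall y, exists x, pi x = y.
Hypothesis ker_sq0 : forall x y, pi x = 0 -> pi y = 0 -> x * y = 0.

(** The kernel is killed by itself, hence is a [K]-vector space: elements
    outside the kernel act on it invertibly. *)
Lemma ker_unit_inj c x : pi c != 0 -> pi x = 0 -> c * x = 0 -> x = 0.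
Proof.
move=> c0 x0 cx0; have [v piv] := pi_surj (pi c)^-1.
have : (c * v - 1) * x = 0.
  by apply: ker_sq0 => //; rewrite rmorphB rmorphM rmorph1 piv mulfV // subrr.
by rewrite mulrBl mul1r mulrAC cx0 mul0r sub0r => /eqP; rewrite oppr_eq0 => /eqP.
Qed.

Lemma ker_lift_div a c : pi a = 0 -> pi c != 0 -> exists2 h, pi h = 0 & c * h = a.
Proof.
move=> a0 c0; have [v piv] := pi_surj (pi c)^-1.
exists (v * a); first by rewrite rmorphM a0 mulr0.
apply/eqP; rewrite -subr_eq0 mulrA -[X in _ - X]mul1r -mulrBl; apply/eqP.
by apply: ker_sq0 => //; rewrite rmorphB rmorphM rmorph1 piv mulfV // subrr.
Qed.

(** The Taylor expansion stops at first order because [h * h = 0]. *)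
Lemma horner_ker_shift (p : {poly E}) x h :
  pi h = 0 -> p.[x + h] = p.[x] + p^`().[x] * h.
Proof.
move=> h0; have hh : h * h = 0 by exact: ker_sq0.
elim/poly_ind: p => [|p c IH]; first by rewrite deriv0 !horner0 mul0r addr0.
rewrite derivD derivM derivX derivC addr0 mulr1 !hornerE IH.
transitivity (p.[x] * x + c + (p^`().[x] * x + p.[x]) * h +
              p^`().[x] * (h * h)); first by ring.
by rewrite hh mulr0 addr0.
Qed.

Lemma pi_horner_shift (p : {poly E}) x h :
  pi h = 0 -> pi p.[x + h] = pi p.[x].
Proof.
by move=> h0; rewrite horner_ker_shift // rmorphD rmorphM h0 mulr0 addr0.
Qed.

Section Extension.
Variables (S : set E) (Sps : partial_section S) (S1 : S 1).

Lemma ps_lead_neq0 (p : {poly E}) :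
  coefs_in S p -> p != 0 -> pi (lead_coef p) != 0.
Proof.
move=> Sp; apply: contraNneq => /(ps_inj Sps (Sp _)) /eqP.
by rewrite lead_coef_eq0.
Qed.

(** Pseudo-division by [p]: multiplying [q] by the leading coefficient of [p]
    and cancelling its leading term lowers the degree without leaving the
    polynomials over [S] that vanish at [pi u]; below the degree of [p] only [0]
    is left.  The leading coefficients of [p] accumulated on the way can be
    cancelled since they act injectively on the kernel. *)
Lemma min_annihilator_vanish (p : {poly E}) u :
  coefs_in S p -> p != 0 -> p.[u] = 0 ->
  (forall q, coefs_in S q -> q != 0 -> pi q.[u] = 0 -> (size p <= size q)%N) ->
  forall q, coefs_in S q -> pi q.[u] = 0 -> q.[u] = 0.
Proof.
move=> Sp p0 pu0 pmin q; have [m] := ubnP (size q).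
elim: m q => // m IH q; rewrite ltnS => szq Sq qu0.
have [->|q0] := eqVneq q 0; first by rewrite horner0.
have pq := pmin q Sq q0 qu0.
have c0 := ps_lead_neq0 Sp p0; apply: (ker_unit_inj c0) => //.
pose r := (lead_coef p)%:P * q - (lead_coef q)%:P * 'X^(size q - size p) * p.
have Sr : coefs_in S r.
  apply: coefs_in_B => //; apply: coefs_in_M => //.
    exact: (coefs_in_C Sps S1 (Sp _)).
  apply: coefs_in_M => //; last exact: coefs_in_Xn.
  exact: (coefs_in_C Sps S1 (Sq _)).
have ru : r.[u] = lead_coef p * q.[u].
  by rewrite hornerD hornerN !hornerM !hornerC pu0 mulr0 subr0.
rewrite -ru; apply: IH => //; last by rewrite ru rmorphM qu0 mulr0.
have szq0 : (0 < size q)%N by rewrite size_poly_gt0.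
have szp0 : (0 < size p)%N by rewrite size_poly_gt0.
apply: leq_trans szq; rewrite -[size q]prednK // ltnS.
apply/leq_sizeP => i iq.
rewrite coefB -mulrA !coefCM coefXnM; case: ltnP => [ilt|ige].
  by exfalso; lia.
have [->|ni] := eqVneq i (size q).-1.
  have -> : ((size q).-1 - (size q - size p) = (size p).-1)%N by lia.
  by rewrite -!/(lead_coef _) mulrC subrr.
have iq' : (size q <= i)%N by rewrite -(prednK szq0) ltn_neqAle eq_sym ni.
have arith a b k : (a <= b -> b <= k -> a <= k - (b - a))%N by lia.
by rewrite !nth_default ?mulr0 ?mulr0 ?subr0 //; exact: arith.
Qed.

Hypothesis char0 : [pchar K] =i pred0.

(** The extension step of Zorn's argument: any element [t] of [K] can be brought
    into the image. *)
Lemma ps_extend t : exists T : set E,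
  [/\ partial_section T, (S `<=` T)%classic & exists2 u, T u & pi u = t].
Proof.
have [u0 piu0] := pi_surj t.
suff [u piu inj] : exists2 u, pi u = t &
    forall q, coefs_in S q -> pi q.[u] = 0 -> q.[u] = 0.
  exists (adjoin S u); split; first exact: adjoin_partial_section.
    exact: adjoin_sub.
  by exists u => //; exact: adjoin_gen.
(* [noalg] is the transcendental case, where any lift of [t] works. *)
have [[p [Sp p0 pt0]]|noalg] := pselect (exists p : {poly E},
    [/\ coefs_in S p, p != 0 & pi p.[u0] = 0]); last first.
  exists u0 => // q Sq qu0; have [->|q0] := eqVneq q 0; first exact: horner0.
  by case: noalg; exists q.
have exm : exists m, `[< exists p : {poly E},
    [/\ coefs_in S p, p != 0, pi p.[u0] = 0 & size p = m] >].
  by exists (size p); apply/asboolP; exists p.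
case: (ex_minnP exm) => [_ /asboolP [{exm Sp p0 pt0}p [Sp p0 pt0 <-]] pmin'].
have {pmin'}pmin q :
    coefs_in S q -> q != 0 -> pi q.[u0] = 0 -> (size p <= size q)%N.
  by move=> Sq q0 qu0; apply: pmin'; apply/asboolP; exists q.
(* Otherwise [p'] would be a nonzero annihilator of smaller degree. *)
have dp0 : pi p^`().[u0] != 0.
  have lc0 := ps_lead_neq0 Sp p0.
  apply/negP => /eqP dpu0.
  have szp : (1 < size p)%N.
    rewrite ltnNge; apply/negP => sz1; move: lc0 pt0.
    by rewrite (size1_polyC sz1) hornerC lead_coefC => /negP lc0 /eqP.
  have dpN0 : p^`() != 0.
    apply/eqP => /(congr1 (fun q : {poly E} => pi q`_(size p).-2)).
    rewrite coef_deriv coef0 rmorph0 prednK -?subn1 ?subn_gt0 // subn1.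
    rewrite rmorphMn -mulr_natr => /eqP; rewrite mulf_eq0 (negPf lc0) /=.
    by move/pcharf0P: char0 => ->; apply/negP; rewrite -lt0n -subn1 subn_gt0.
  have := pmin _ (coefs_in_deriv Sps S1 Sp) dpN0 dpu0.
  by rewrite leqNgt lt_size_deriv.
(* Newton step: [u0 - h] with [h = p(u0) / p'(u0)] is an exact root of [p]. *)
have [h h0 hE] := ker_lift_div pt0 dp0.
have h'0 : pi (- h) = 0 by rewrite rmorphN h0 oppr0.
exists (u0 - h); first by rewrite rmorphB h0 subr0.
apply: (min_annihilator_vanish Sp p0).
  by rewrite horner_ker_shift // mulrN hE subrr.
by move=> q Sq q0; rewrite pi_horner_shift //; exact: pmin.
Qed.

End Extension.

(** This partial section shows that a maximal one is not empty. *)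
Lemma prime_partial_section :
  [pchar K] =i pred0 -> partial_section (fun x => exists m : int, x = m%:~R).
Proof.
move=> char0; split.
- by move=> _ _; exists 1.
- by move=> _ _ [a ->] [b ->]; exists (a - b); rewrite rmorphB.
- by move=> _ _ [a ->] [b ->]; exists (a * b); rewrite rmorphM.
move=> _ [m ->]; rewrite rmorph_int => /eqP m0.
suff /eqP -> : m == 0 by [].
case: m m0 => k.
  by rewrite -pmulrn; move/pcharf0P: char0 => ->.
by rewrite NegzE mulrNz oppr_eq0 -pmulrn; move/pcharf0P: char0 => ->.
Qed.

Theorem ring_section_sq0 : [pchar K] =i pred0 ->
  exists s : K -> E, [/\ cancel s pi, {morph s : x y / x + y} &
                        {morph s : x y / x * y}].
Proof.
move=> char0.
have [S [Sps Smax]] := Zorn_bigcup partial_section_bigcup.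
have maxE T : partial_section T -> (S `<=` T)%classic -> (T `<=` S)%classic.
  move=> Tps ST; apply: contrapT => TS; exact: (Smax T).
have S1 : S 1.
  have [[x Sx]|Sno] := pselect (exists x, S x); first exact: (ps_1 Sps Sx).
  apply: (maxE _ (prime_partial_section char0)); last by exists 1.
  by move=> x Sx; case: Sno; exists x.
have onto t : exists u, S u /\ pi u = t.
  have [T [Tps ST [u Tu piu]]] := ps_extend Sps S1 char0 t.
  by exists u; split=> //; exact: (maxE T).
have [s sP] := choice onto.
have uniqS x y : S x -> S y -> pi x = pi y -> x = y.
  move=> Sx Sy xy; apply/eqP; rewrite -subr_eq0; apply/eqP.
  by apply: (ps_inj Sps); [exact: (ps_B Sps) | rewrite rmorphB xy subrr].
have sS t : S (s t) by have [] := sP t.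
have sK t : pi (s t) = t by have [] := sP t.
exists s; split=> // x y; apply: uniqS => //.
- exact: ps_D.
- by rewrite rmorphD !sK.
- exact: (ps_M Sps).
- by rewrite rmorphM !sK.
Qed.

End Lifting.

(** * Symmetric cocycles are coboundaries *)

Record symmetric_cocycle (K : comNzRingType) (B : K -> K -> K) : Prop :=
  SymmetricCocycle {
  cocycle_sym : forall x y, B x y = B y x;
  cocycle_addl : forall x y z, B (x + y) z = B x z + B y z;
  cocycle_eq : forall x y z, B (x * y) z + B x y * z = x * B y z + B x (y * z) }.

Section SquareZeroExtension.
Variables (K : fieldType) (B : K -> K -> K) (Bc : symmetric_cocycle B).

Lemma cocycle_1l z : B 1 z = B 1 1 * z.
Proof. by have := cocycle_eq Bc 1 1 z; rewrite !mul1r => /addrI. Qed.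

(** The proof [Bc] is an argument of the type so that the ring structure, which
    depends on it, can be inferred from the type alone. *)
Definition extension of symmetric_cocycle B : Type := (K * K)%type.
Local Notation E := (extension Bc).

HB.instance Definition _ := GRing.Zmodule.on E.

(** Since [B 1 z = B 1 1 * z], the second component [- B 1 1] cancels the twist
    that [(1, 0)] would introduce. *)
Definition ext_one : E := (1, - B 1 1).
Definition ext_mul (x y : E) : E :=
  (x.1 * y.1, x.1 * y.2 + x.2 * y.1 + B x.1 y.1).

Fact ext_mulC : commutative ext_mul.
Proof.
by move=> [x a] [y b]; congr (_, _) => /=; rewrite 1?(cocycle_sym Bc y x); ring.
Qed.

Fact ext_mulA : associative ext_mul.
Proof.
move=> [x a] [y b] [z c]; congr (_, _) => /=; first by ring.
have := cocycle_eq Bc x y z => cocy.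
transitivity (x * (y * c) + x * (b * z) + a * (y * z)
              + (x * B y z + B x (y * z))); first by ring.
by rewrite -cocy; ring.
Qed.

Fact ext_mul1 : left_id ext_one ext_mul.
Proof.
by move=> [x a]; congr (_, _) => /=; rewrite ?(cocycle_1l x); ring.
Qed.

Fact ext_mulD : left_distributive ext_mul +%R.
Proof.
by move=> [x a] [y b] [z c]; congr (_, _) => /=; rewrite ?(cocycle_addl Bc); ring.
Qed.

Fact ext_one_neq0 : ext_one != 0.
Proof. by apply/eqP => -[/eqP]; rewrite oner_eq0. Qed.

HB.instance Definition _ := GRing.Zmodule_isComNzRing.Build E
  ext_mulA ext_mulC ext_mul1 ext_mulD ext_one_neq0.

Definition ext_proj (x : E) : K := x.1.

Fact ext_proj_zmod : zmod_morphism ext_proj. Proof. by []. Qed.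
Fact ext_proj_monoid : monoid_morphism ext_proj. Proof. by []. Qed.
HB.instance Definition _ := GRing.isZmodMorphism.Build E K ext_proj ext_proj_zmod.
HB.instance Definition _ :=
  GRing.isMonoidMorphism.Build E K ext_proj ext_proj_monoid.

Lemma cocycle_0 : B 0 0 = 0.
Proof.
have := cocycle_addl Bc 0 0 0; rewrite addr0 => /eqP.
by rewrite -subr_eq0 opprD addrA subrr sub0r oppr_eq0 => /eqP.
Qed.

(** The second component of a ring section is the required function. *)
Theorem symmetric_cocycle_coboundary : [pchar K] =i pred0 ->
  exists f : K -> K, {morph f : x y / x + y} /\
    (forall x y, f (x * y) = x * f y + f x * y + B x y).
Proof.
move=> char0.
have [||s [sK sD sM]] := @ring_section_sq0 E K ext_proj _ _ char0.
- by move=> y; exists (y, 0).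
- move=> [x a] [y b]; rewrite /ext_proj /= => -> ->.
  by congr (_, _) => /=; rewrite ?cocycle_0; ring.
have s1 x : (s x).1 = x by exact: sK.
exists (fun x => (s x).2); split=> x y; first by rewrite sD.
by rewrite sM /= !s1.
Qed.

End SquareZeroExtension.

(** * The cocycle attached to the product rules *)

Lemma triangular_sum (V : nmodType) (F : nat -> nat -> V) N :
  \sum_(m < N.+1) \sum_(i < m.+1) F i (m - i)%N =
  \sum_(i < N.+1) \sum_(j < (N - i).+1) F i j.
Proof.
elim: N => [|N IH]; first by rewrite !big_ord1.
rewrite big_ord_recr /= IH [X in _ + X]big_ord_recr [RHS]big_ord_recr /=.
rewrite subnn big_ord1 addrA; congr (_ + _); rewrite -big_split.
by apply: eq_bigr => i _; rewrite [RHS]big_ord_recr /= subSn // -ltnS.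
Qed.

Section LeibnizCocycle.
Variables (K : comNzRingType) (n : nat).
Variables (Gamma : nat -> nat -> K) (e : nat -> K -> K).

Definition leibniz_sum k x y :=
  \sum_(i < k.+1) Gamma i (k - i)%N * e i x * e (k - i)%N y.

(** Both sides are the sum over [i + j + k = n] of [e i x * e j y * e k z], with
    the two coefficients that the equation of [Gamma] identifies. *)
Lemma leibniz_sumA x y z :
  (forall i j k : nat, (i + j + k <= n)%N ->
     Gamma (i + j)%N k * Gamma i j = Gamma i (j + k)%N * Gamma j k) ->
  \sum_(m < n.+1) Gamma m (n - m)%N * leibniz_sum m x y * e (n - m)%N z =
  \sum_(i < n.+1) Gamma i (n - i)%N * e i x * leibniz_sum (n - i) y z.
Proof.
move=> Gc; pose F i j := Gamma i (n - i)%N * Gamma j (n - i - j)%N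
                          * (e i x * e j y * e (n - i - j)%N z).
transitivity (\sum_(m < n.+1) \sum_(i < m.+1) F i (m - i)%N).
  apply: eq_bigr => m _; rewrite mulr_sumr mulr_suml; apply: eq_bigr => i _.
  have mn : (m <= n)%N by rewrite -ltnS.
  have im : (i <= m)%N by rewrite -ltnS.
  rewrite /F; have -> : (n - i - (m - i) = n - m)%N by lia.
  have := Gc i (m - i)%N (n - m)%N.
  have -> : (i + (m - i) = m)%N by lia.
  have -> : (m - i + (n - m) = n - i)%N by lia.
  by move=> <-; [ring | lia].
rewrite triangular_sum; apply: eq_bigr => i _; rewrite mulr_sumr.
by apply: eq_bigr => j _; rewrite /F; ring.
Qed.

(** Setting the top function [e n] to zero keeps only the middle terms.  The
    product rule is then unavailable at [n], where [e n (x * y) = 0]; the terms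
    [leibniz_sum n x y * z] and [x * leibniz_sum n y z] of the cocycle equation
    are precisely what is missing to apply [leibniz_sumA]. *)
Lemma leibniz_cocycle :
  (forall i j : nat, (i + j <= n)%N -> Gamma i j = Gamma j i) ->
  Gamma 0%N n = 1 -> Gamma n 0%N = 1 ->
  (forall i j k : nat, (i + j + k <= n)%N ->
     Gamma (i + j)%N k * Gamma i j = Gamma i (j + k)%N * Gamma j k) ->
  (forall x, e 0%N x = x) -> (forall x, e n x = 0) ->
  (forall k, (k <= n)%N -> {morph e k : x y / x + y}) ->
  (forall k, (k < n)%N -> forall x y, e k (x * y) = leibniz_sum k x y) ->
  symmetric_cocycle (leibniz_sum n).
Proof.
move=> Gsym G0n Gn0 Gc e0 en eD eM; split.
- move=> x y; rewrite /leibniz_sum (reindex_inj rev_ord_inj) /=.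
  apply: eq_bigr => i _; have ilen : (i <= n)%N by rewrite -ltnS.
  by rewrite subSS subKn // Gsym ?subnK // mulrAC.
- move=> x y z; rewrite /leibniz_sum -big_split; apply: eq_bigr => i _ /=.
  by rewrite eD ?mulrDr ?mulrDl // -ltnS.
move=> x y z.
have <- : \sum_(m < n.+1) Gamma m (n - m)%N * leibniz_sum m x y * e (n - m)%N z
    = leibniz_sum n (x * y) z + leibniz_sum n x y * z.
  rewrite [leibniz_sum n (x * y) z]/leibniz_sum.
  rewrite [LHS]big_ord_recr [in RHS]big_ord_recr /=.
  rewrite subnn Gn0 en e0 mulr0 mul0r addr0 mul1r; congr (_ + _).
  by apply: eq_bigr => m _; rewrite eM.
rewrite leibniz_sumA // [leibniz_sum n x (y * z)]/leibniz_sum.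
rewrite [LHS]big_ord_recl [in RHS]big_ord_recl /=.
rewrite subn0 G0n e0 en mulr0 add0r mul1r.
congr (_ + _); apply: eq_bigr => i _; rewrite eM // ltn_subrL /=.
exact: leq_ltn_trans (ltn_ord i).
Qed.

End LeibnizCocycle.

Lemma leibniz_sum_top (K : comNzRingType) (Gamma : nat -> nat -> K)
    (d : nat -> K -> K) (f : K -> K) n x y :
  (0 < n)%N -> Gamma 0%N n = 1 -> Gamma n 0%N = 1 -> d 0%N = id ->
  leibniz_sum Gamma [eta d with n |-> f] n x y =
  x * f y + f x * y + leibniz_sum Gamma [eta d with n |-> fun=> 0] n x y.
Proof.
case: n => // n _ G0n Gn0 d0; rewrite /leibniz_sum.
rewrite [LHS]big_ord_recl [in LHS]big_ord_recr.
rewrite [in RHS]big_ord_recl [in RHS]big_ord_recr.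
rewrite /= subn0 subnn G0n Gn0 d0 eqxx /= !mul1r mulr0 mul0r add0r addr0.
rewrite [X in _ + X]addrC addrA; congr (_ + _); apply: eq_bigr => i _.
have := ltn_ord i => ilt.
by rewrite !ltn_eqF // /bump /=; lia.
Qed.

Theorem theorem3 (R : realType) (n : nat) (hn : (2 <= n)%N)
  (Gamma : nat -> nat -> R)
  (Gamma_sym : forall i j : nat, (i, j) \in Delta n -> Gamma i j = Gamma j i)
  (Gamma1 : forall i j : nat,
     (i, j) \in Delta n -> (i * j)%N = 0%N -> Gamma i j = 1)
  (Gamma_cocycle : forall i j k : nat, (i + j + k <= n)%N ->
     Gamma (i + j)%N k * Gamma i j = Gamma i (j + k)%N * Gamma j k)
  (d : nat -> R -> R)
  (d0 : d 0%N = id)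
  (d_add : forall k : nat, (1 <= k <= n - 1)%N -> {morph d k : x y / x + y})
  (d_rule : forall k : nat, (1 <= k <= n - 1)%N -> product_rule Gamma d k) :
  exists dn : R -> R,
    {morph dn : x y / x + y} /\
    product_rule Gamma [eta d with n |-> dn] n.
Proof.
have n0 : (0 < n)%N by exact: ltnW.
have G0n : Gamma 0%N n = 1 by apply: Gamma1; rewrite // inE /=.
have Gn0 : Gamma n 0%N = 1 by apply: Gamma1; rewrite ?muln0 // inE /= addn0.
pose e : nat -> R -> R := [eta d with n |-> fun=> 0].
have elt k : (k < n)%N -> e k = d k.
  by move=> kn; rewrite /e /= ltn_eqF.
have en x : e n x = 0 by rewrite /e /= eqxx.
have Bc : symmetric_cocycle (leibniz_sum Gamma e n).
  apply: leibniz_cocycle => //.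
  - by move=> x; rewrite elt // d0.
  - move=> k; rewrite leq_eqVlt => /orP[/eqP ->|kn] x y.
      by rewrite !en addr0.
    rewrite elt //; case: k kn => [|k] kn; first by rewrite d0.
    by rewrite d_add //; lia.
  move=> k kn x y; rewrite elt //.
  transitivity (\sum_(i < k.+1) Gamma i (k - i)%N * d i x * d (k - i)%N y).
    case: k kn => [|k] kn; last by apply: d_rule; lia.
    by rewrite big_ord1 /= d0 Gamma1 ?mul1r // inE.
  by apply: eq_bigr => i _; rewrite !elt //; have := ltn_ord i; lia.
have [f [fD fM]] := symmetric_cocycle_coboundary Bc (pchar_num R).
exists f; split=> // x y; rewrite [LHS]/= eqxx fM.
by rewrite -(leibniz_sum_top f x y n0 G0n Gn0 d0).
Qed.
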